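(* Let $ABC$ be a triangle. Draw $a$ cevians from vertex $A$, $b$ cevians from vertex $B$, and $c$ cevians from vertex $C$ (where $a,b,c \ge 0$ are integers and the cevians from each vertex are distinct). Then the number of triangles formed in the resulting figure (consisting of the three sides of $ABC$ together with all the cevians) is $$\binom{a+b+c+3}{3}-\binom{a+2}{3}-\binom{b+2}{3}-\binom{c+2}{3}-d,$$ where $d$ is the number of points in the interior of triangle $ABC$ at which three cevians meet.
   Context: A cevian of triangle $ABC$ is a line segment joining a vertex of the triangle to a point in the interior of the opposite side. A ''triangle formed'' in the figure means a triangle whose three sides each lie along one of the drawn segments (the three sides of $ABC$ or the cevians), with vertices at intersection points of these segments; triangles may be unions of smaller regions. $\binom{n}{3}=n(n-1)(n-2)/6$. *)

(* Defs.v *)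
From mathcomp Require Import all_boot all_order all_algebra finmap.
From mathcomp Require Import boolp classical_sets functions cardinality reals.
From mathcomp Require Import topology normedtype.

Set Implicit Arguments.
Unset Strict Implicit.
Unset Printing Implicit Defensive.

Import Order.TTheory GRing.Theory Num.Theory.
Import numFieldNormedType.Exports.

Local Open Scope classical_set_scope.
Local Open Scope ring_scope.

Definition plane (R : realType) := 'rV[R]_2.

Definition noncollinear (R : realType) (P Q S : plane R) : bool :=
  free [:: Q - P; S - P].

Definition segment (R : realType) (P Q : plane R) : set (plane R) :=
  [set X | exists t : R, 0 <= t <= 1 /\ X = (1 - t) *: P + t *: Q].

Definition open_segment (R : realType) (P Q : plane R) : set (plane R) :=
  [set X | exists t : R, 0 < t < 1 /\ X = (1 - t) *: P + t *: Q].

Definition triangle_region (R : realType) (P Q S : plane R) : set (plane R) :=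
  [set X | exists x y z : R,
     [/\ 0 <= x, 0 <= y, 0 <= z, x + y + z = 1 &
         X = x *: P + y *: Q + z *: S]].

Definition is_cevian (R : realType) (V P Q : plane R) (s : set (plane R)) :
    Prop :=
  exists2 D : plane R, open_segment P Q D & s = segment V D.

Definition sides (R : realType) (A B C : plane R) : set (set (plane R)) :=
  [set segment B C; segment C A; segment A B].

(* A triangle is represented by the set of its three vertices.  Each vertex
   lies on two of s1, s2, s3, hence is an intersection point of drawn
   segments; noncollinearity forces s1, s2, s3 to be distinct. *)
Definition formed_triangles (R : realType) (drawn : set (set (plane R))) :
    set {fset plane R} :=
  [set T | exists P Q S : plane R,
     [/\ noncollinear P Q S, T = [fset P; Q; S]%fset &
         exists s1 s2 s3 : set (plane R),
           [/\ drawn s1, drawn s2 & drawn s3] /\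
           [/\ segment Q S `<=` s1, segment S P `<=` s2
             & segment P Q `<=` s3]]].

Definition triple_points (R : realType) (A B C : plane R)
    (cevians : set (set (plane R))) : set (plane R) :=
  [set X | interior (triangle_region A B C) X /\
     exists s1 s2 s3 : set (plane R),
       [/\ cevians s1, cevians s2 & cevians s3] /\
       [/\ s1 <> s2, s2 <> s3 & s1 <> s3] /\
       [/\ s1 X, s2 X & s3 X]].

(* Main.v *)
(** A side is a degenerate cevian: AB, BC and CA are the cevians from A, B and C
    whose foot is B, C and A.  Any two of the [a + b + c + 3] drawn segments then
    meet in exactly one point, so triangles correspond to triples of segments
    without a common point.  A concurrent triple meets at a vertex, or at an
    interior point through which exactly three cevians pass, one from each
    vertex; [a + 2] segments pass through A, and likewise for B and C. *)
Require Import Defs.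
From mathcomp Require Import all_boot all_order all_algebra finmap.
From mathcomp Require Import boolp classical_sets functions cardinality reals.
From mathcomp Require Import topology normedtype.
From mathcomp Require Import ring lra zify.

Import Order.TTheory GRing.Theory Num.Theory.
Import numFieldNormedType.Exports.

Local Open Scope classical_set_scope.
Local Open Scope ring_scope.

Set Implicit Arguments.
Unset Strict Implicit.

(** * Counting through injections, and affine combinations *)

(** Counting is transported to a finite type: triangles will be counted by their sets of sidelines,
    and crossing points by the sets of segments through them. *)
Lemma card_fset_set_inj (T : choiceType) (F : finType) (A : set T) (f : T -> F)
    (f_inj : forall x y, A x -> A y -> f x = f y -> x = y) :
  finite_set A /\
  #|` fset_set A|%fset = #|finset (fun y => `[< exists2 x, A x & f x = y >])|.
Proof.
have finfA : finite_set (f @` A) by exact: finite_finset.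
have fA : (f @` A #= A)%card.
  by apply: inj_card_eq => x y /set_mem Ax /set_mem Ay; exact: f_inj.
have finA : finite_set A by rewrite -(eq_finite_set fA).
split=> //; move/fcard_eq: fA => /(_ finfA finA) <-.
have /card_uniqP <- := fset_uniq (fset_set (f @` A)).
apply: eq_card => y; rewrite [in RHS]inE; transitivity (y \in fset_set (f @` A)) => //.
by rewrite in_fset_set //; apply/idP/asboolP; rewrite inE.
Qed.

Lemma in_set3 (T : finType) (x y z u : T) :
  (u \in x |: [set y; z])%SET = [|| u == x, u == y | u == z].
Proof. by rewrite !inE. Qed.

Lemma sub_affine (K : pzRingType) (E : lmodType K) (W e : E) (p q : K) :
  (W + q *: e) - (W + p *: e) = (q - p) *: e.
Proof. by rewrite opprD addrACA subrr add0r scalerBl. Qed.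

Lemma affine_comb (K : pzRingType) (E : lmodType K) (P Q : E) (k : K) :
  (1 - k) *: P + k *: Q = P + k *: (Q - P).
Proof. by rewrite scalerBl scale1r scalerBr [k *: Q - _]addrC addrA. Qed.

Lemma segment_ends (R : realType) (P Q : plane R) : segment P Q P /\ segment P Q Q.
Proof.
split.
  by exists 0; rewrite lexx ler01 subr0 scale1r scale0r addr0.
by exists 1; rewrite lexx ler01 subrr scale1r scale0r add0r.
Qed.

(** * Collinear triples of points *)

Section Collinear.
Variable R : realType.
Implicit Types P Q S W e : plane R.

Lemma noncollinear_neq P Q S : noncollinear P Q S ->
  [/\ P <> Q, Q <> S & S <> P].
Proof.
rewrite /noncollinear free_cons seq1_free span_seq1 => /andP[QP SP].
split=> E; subst.
- by rewrite subrr mem0v in QP.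
- by rewrite memv_line in QP.
- by rewrite subrr eqxx in SP.
Qed.

Lemma noncollinear_line P Q S W e (p q s : R) :
  P = W + p *: e -> Q = W + q *: e -> S = W + s *: e -> ~~ noncollinear P Q S.
Proof.
move=> PE QE SE; apply/negP => PQS; have [_ _ SP] := noncollinear_neq PQS.
have sp : s - p != 0.
  by rewrite subr_eq0; apply/eqP => sp; apply: SP; rewrite SE sp PE.
move: PQS; rewrite /noncollinear free_cons span_seq1 => /andP[+ _].
apply/negP; rewrite negbK.
apply/vlineP; exists ((q - p) / (s - p)).
by rewrite QE SE PE !sub_affine scalerA divfK.
Qed.

Lemma collinear_comb P Q S : P <> S -> ~~ noncollinear P Q S ->
  exists k : R, Q = (1 - k) *: P + k *: S.
Proof.
move=> PS; rewrite /noncollinear free_cons seq1_free span_seq1.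
rewrite (_ : S - P != 0); last by rewrite subr_eq0 eq_sym; apply/eqP.
rewrite andbT negbK => /vlineP[k kE]; exists k.
by rewrite affine_comb -kE addrC subrK.
Qed.

End Collinear.

(** * Triangles formed by pairwise crossing segments *)

Section Arrangement.
Variables (R : realType) (L : finType) (seg : L -> set (plane R)).
Hypothesis seg_convex : forall i P Q, seg i P -> seg i Q -> segment P Q `<=` seg i.
Hypothesis seg_meet : forall i j, i != j -> exists X, seg i X /\ seg j X.
Hypothesis seg_uniq : forall i j X Y, i != j ->
  seg i X -> seg j X -> seg i Y -> seg j Y -> X = Y.
Hypothesis seg_line : forall i P Q S,
  seg i P -> seg i Q -> seg i S -> ~~ noncollinear P Q S.
(** Each segment is maximal: a drawn point on the line spanned by two points of the segment lies on
    the segment itself. This is what turns a collinear choice of vertices into concurrency. *)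
Hypothesis seg_extend : forall i j P Q S, seg i P -> seg i S -> P <> S ->
  seg j Q -> ~~ noncollinear P Q S -> seg i Q.

Definition through X : {set L} := finset (fun i => `[< seg i X >]).

Lemma in_through X i : (i \in through X) <-> seg i X.
Proof. by rewrite inE; split=> /asboolP. Qed.

Definition concurrent (W : {set L}) := `[< exists X, W \subset through X >].

Lemma concurrent3 i j k :
  concurrent (i |: [set j; k])%SET <-> exists X, [/\ seg i X, seg j X & seg k X].
Proof.
split=> [/asboolP[X /fintype.subsetP sX]|[X [iX jX kX]]].
  by exists X; split; apply/in_through/sX; rewrite !inE eqxx ?orbT.
apply/asboolP; exists X; apply/fintype.subsetP => l.
by rewrite in_set3 => /or3P[] /eqP->; apply/in_through.
Qed.

(* A segment is a sideline of a formed triangle exactly when it contains two of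
   its vertices. *)
Definition sidelines (T : {fset plane R}) : {set L} :=
  finset (fun i => `[< exists P Q, [/\ P \in T, Q \in T, P <> Q, seg i P & seg i Q] >]).

(** Each index names the side opposite a vertex: [i] faces [P], [j] faces [Q], [k] faces [S]. Two
    equal indices would put all three vertices on one segment, and a point common to all three
    segments would equal both [P] and [Q] by [seg_uniq]. *)
Lemma formedP T : formed_triangles (range seg) T -> exists i j k P Q S,
  [/\ [/\ i != j, j != k & k != i], [/\ P <> Q, Q <> S & S <> P],
      T = [fset P; Q; S]%fset, [/\ seg j P, seg k P, seg k Q & seg i Q] /\
      [/\ seg i S & seg j S] & ~~ concurrent (i |: [set j; k])%SET].
Proof.
move=> [P [Q [S [PQS TE [s1 [s2 [s3 [[]]]]]]]]].
move=> [i _ <-] [j _ <-] [k _ <-] [QSi SPj PQk].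
have [PQ QS SP] := noncollinear_neq PQS.
have [iQ iS] : seg i Q /\ seg i S by split; apply: QSi; have [] := segment_ends Q S.
have [jS jP] : seg j S /\ seg j P by split; apply: SPj; have [] := segment_ends S P.
have [kP kQ] : seg k P /\ seg k Q by split; apply: PQk; have [] := segment_ends P Q.
have ij : i != j.
  by apply/eqP => ij; subst j; have := seg_line jP iQ iS; rewrite PQS.
have jk : j != k.
  by apply/eqP => jk; subst k; have := seg_line jP kQ jS; rewrite PQS.
have ki : k != i.
  by apply/eqP => ki; subst k; have := seg_line kP iQ iS; rewrite PQS.
exists i, j, k, P, Q, S; split=> //.
apply/negP => /concurrent3[X [iX jX kX]].
by apply: PQ; rewrite -(seg_uniq jk jX kX jP kP) (seg_uniq ki kX iX kQ iQ).
Qed.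

(** A segment through two of the vertices shares two points with one of [i], [j], [k], hence equals
    it by [seg_uniq]. *)
Lemma sidelines3 i j k P Q S :
  [/\ i != j, j != k & k != i] -> [/\ P <> Q, Q <> S & S <> P] ->
  [/\ seg j P, seg k P, seg k Q & seg i Q] -> [/\ seg i S & seg j S] ->
  sidelines [fset P; Q; S]%fset = (i |: [set j; k])%SET.
Proof.
move=> [ij jk ki] [PQ QS SP] [jP kP kQ iQ] [iS jS]; apply/setP => l.
rewrite in_set3 inE; apply/asboolP/or3P.
  have side m X Y : X <> Y -> seg m X -> seg m Y -> seg l X -> seg l Y -> l == m.
    by move=> XY mX mY lX lY; apply/negP => /negP lm; apply: XY; exact: (seg_uniq lm).
  move=> [X [Y []]]; rewrite !inE -!orbA.
  move=> /or3P[]/eqP-> /or3P[]/eqP-> // XY lX lY;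
    by [constructor 1; apply: side lX lY | constructor 2; apply: side lX lY
       | constructor 3; apply: side lX lY].
by case=> /eqP->; [exists Q, S | exists S, P | exists P, Q];
  split=> //; rewrite !inE eqxx ?orbT.
Qed.

(** The map [sidelines] is a bijection from formed triangles onto non-concurrent triples; its
    inverse takes the pairwise meeting points. *)
Lemma formed_triangles_card :
  finite_set (formed_triangles (range seg)) /\
  #|` fset_set (formed_triangles (range seg))|%fset =
    #|finset (fun W : {set L} => (#|W| == 3) && ~~ concurrent W)|.
Proof.
have [|finT ->] := @card_fset_set_inj _ _ (formed_triangles (range seg)) sidelines.
  (* Injectivity: the vertices are recovered as the points where two distinct sidelines meet. *)
  suff vertexE T : formed_triangles (range seg) T -> forall X, X \in T <->
      exists i j, [/\ i \in sidelines T, j \in sidelines T, i != j, seg i X & seg j X].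
    move=> T U /vertexE TE /vertexE UE TU; apply/fsetP => X.
    by apply/idP/idP => [/TE|/UE]; [rewrite TU => /UE|rewrite -TU => /TE].
  move=> /formedP[i [j [k [P [Q [S [ijk PQS -> [jkP ijS] _]]]]]]] X.
  rewrite (sidelines3 ijk PQS) //.
  case: ijk PQS jkP ijS => ij jk ki [PQ QS SP] [jP kP kQ iQ] [iS jS]; split.
    rewrite !inE -!orbA => /or3P[] /eqP->; [exists j, k|exists k, i|exists i, j];
      by split=> //; rewrite !inE eqxx ?orbT.
  move=> [l [m []]]; rewrite !in_set3 => lijk mijk lm lX mX.
  rewrite !inE -!orbA; apply/or3P.
  move: lijk mijk lm lX mX => /or3P[]/eqP-> /or3P[]/eqP-> ; rewrite ?eqxx // => _ lX mX;
    by [constructor 1; apply/eqP; apply: (seg_uniq jk)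
       | constructor 2; apply/eqP; apply: (seg_uniq ki)
       | constructor 3; apply/eqP; apply: (seg_uniq ij)].
split=> //; apply: eq_card => W; rewrite !inE; apply/asboolP/andP.
  move=> [T /formedP[i [j [k [P [Q [S [ijk PQS -> [jkP ijS] nc]]]]]]]].
  rewrite (sidelines3 ijk PQS) // => <-; split=> //.
  by case: ijk => ij jk ki; rewrite cardsU1 cards2 !inE negb_or ij jk [i == k]eq_sym ki.
move=> [W3 ncW].
have [i iW] : exists i, i \in W by apply/set0Pn; rewrite -card_gt0 (eqP W3).
have /cards2P[j [k [jk WE]]] : #|(W :\ i)%SET| == 2.
  by apply/eqP; have := cardsD1 i W; rewrite iW (eqP W3) add1n => -[<-].
have {iW}WE : W = (i |: [set j; k])%SET by rewrite -WE finset.setD1K.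
have [ij ik] : i != j /\ i != k.
  apply/andP; move: W3; rewrite WE cardsU1 cards2 jk !inE negb_or.
  by case: (_ && _).
have nc : ~ exists X, [/\ seg i X, seg j X & seg k X].
  by move/concurrent3; apply/negP; rewrite -WE.
rewrite {W W3 ncW}WE.
(* Surjectivity: the three pairwise meeting points of a non-concurrent triple are the vertices. *)
have [P [jP kP]] := seg_meet jk.
have [Q [iQ kQ]] := seg_meet ik.
have [S [iS jS]] := seg_meet ij.
have PQ : P <> Q by move=> PQ; apply: nc; exists P; split=> //; rewrite PQ.
have QS : Q <> S by move=> QS; apply: nc; exists Q; split=> //; rewrite QS.
have SP : S <> P by move=> SP; apply: nc; exists S; split=> //; rewrite SP.
exists [fset P; Q; S]%fset; last by apply: sidelines3; first by split; rewrite // eq_sym.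
exists P, Q, S; split=> //.
  (* If the points were collinear, [Q] would lie on segment [j], which contains [P] and [S], so [Q]
     would be common to all three segments. *)
  apply/negPn/negP => col; apply: nc; exists Q; split=> //.
  by apply: (seg_extend jP jS _ iQ col) => /esym.
exists (seg i), (seg j), (seg k); split; first by split; [exists i|exists j|exists k].
by split; apply: seg_convex.
Qed.
End Arrangement.

(** * Vertex indices modulo 3 *)

(** Starting the sum at an arbitrary [v] lets one computation serve all three vertices by cyclic
    symmetry. *)
Lemma big_ord3_cycle (M : nmodType) (F : 'I_3 -> M) v :
  \sum_w F w = F v + F (v + 1) + F (v + 2).
Proof.
rewrite !big_ord_recl big_ord0 addr0; case: v => [[|[|[|//]]] ?];
  rewrite -?addrA; [|rewrite [F _ + (_ + _)]addrC -addrA|rewrite addrA addrC];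
  by congr (F _ + (F _ + F _)); exact: val_inj.
Qed.

Lemma ord3_cases (v w : 'I_3) : [\/ w = v, w = v + 1 | w = v + 2].
Proof.
by case: v w => [[|[|[|//]]] ?] [[|[|[|//]]] ?];
  solve [constructor 1; exact: val_inj | constructor 2; exact: val_inj
        | constructor 3; exact: val_inj].
Qed.

Lemma ord3_neq (v : 'I_3) : [/\ v + 1 != v, v + 2 != v & v + 2 != v + 1].
Proof. by case: v => [[|[|[|//]]] ?]. Qed.

Lemma ord3_add (v : 'I_3) :
  [/\ v + 1 + 1 = v + 2, v + 1 + 2 = v, v + 2 + 1 = v & v + 2 + 2 = v + 1].
Proof. by case: v => [[|[|[|//]]] ?]; split; exact: val_inj. Qed.

(** * Cevians in barycentric coordinates *)

Section Barycentric.
(** The numbers [al X v] are the normalized barycentric coordinates of [X] with respect to the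
    vertices [V v]; [alK] expresses their uniqueness. *)
Variables (R : realType) (V : 'I_3 -> plane R) (al : plane R -> 'I_3 -> R).
Hypothesis al_sum : forall X, \sum_v al X v = 1.
Hypothesis alE : forall X, X = \sum_v al X v *: V v.
Hypothesis alK : forall c : 'I_3 -> R, \sum_v c v = 1 ->
  forall v, al (\sum_w c w *: V w) v = c v.
Implicit Types (P Q S X Y : plane R) (v w : 'I_3) (s t : R).

Lemma al_inj X Y v : al X v = al Y v -> al X (v + 1) = al Y (v + 1) -> X = Y.
Proof.
move=> e0 e1; have := al_sum Y; rewrite -(al_sum X) !(big_ord3_cycle _ v) e0 e1.
by move/addrI => e2; rewrite (alE X) (alE Y) !(big_ord3_cycle _ v) e0 e1 e2.
Qed.

Lemma al_comb P Q s v :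
  al ((1 - s) *: P + s *: Q) v = (1 - s) * al P v + s * al Q v.
Proof.
rewrite -(alK (c := fun w => (1 - s) * al P w + s * al Q w)).
  apply: (congr1 (al^~ v)); rewrite {1}(alE P) {1}(alE Q) !scaler_sumr -big_split.
  by apply: eq_bigr => w _; rewrite [RHS]scalerDl !scalerA.
by rewrite big_split /= -!mulr_sumr !al_sum !mulr1 subrK.
Qed.

Lemma al_vertex v w : al (V v) w = (w == v)%:R.
Proof.
rewrite -[RHS](alK (c := fun w => (w == v)%:R)).
  apply: (congr1 (al^~ w)); rewrite (bigD1 v) //= eqxx scale1r big1 ?addr0 // => u.
  by move/negPf->; rewrite scale0r.
by rewrite (bigD1 v) //= eqxx big1 ?addr0 // => u /negPf->.
Qed.

(* Cevian from [V v] whose foot divides the opposite side in ratio [t : 1 - t];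
   [t = 0] gives the side from [V v] to [V (v + 1)].  Indices are modulo 3. *)
Definition ray v t := segment (V v) ((1 - t) *: V (v + 1) + t *: V (v + 2)).

(** Along a line through [V v] the other two coordinates keep the ratio they have at the foot,
    namely [1 - t] to [t]. Incidence with a cevian thus becomes a single linear equation, plus
    signs. *)
Lemma rayP v t X : 0 <= t <= 1 ->
  ray v t X <->
  (forall w, 0 <= al X w) /\ t * al X (v + 1) = (1 - t) * al X (v + 2).
Proof.
have [e1 e2 e3] := ord3_neq v.
move=> /andP[t0 t1]; split=> [[s [/andP[s0 s1] ->]]|[X0 Xt]].
  have alX w : al ((1 - s) *: V v + s *: ((1 - t) *: V (v + 1) + t *: V (v + 2))) w
     = (1 - s) * (w == v)%:R + s * ((1 - t) * (w == v + 1)%:R + t * (w == v + 2)%:R).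
    by rewrite !al_comb !al_vertex.
  split=> [w|].
    rewrite alX addr_ge0 // mulr_ge0 ?ler0n ?subr_ge0 //.
    by rewrite addr_ge0 // mulr_ge0 ?ler0n ?subr_ge0.
  rewrite !alX !eqxx (negPf e1) (negPf e2) (negPf e3) [v + 1 == _]eq_sym (negPf e3).
  by rewrite !mulr1n !mulr0n; ring.
(* The parameter along the cevian is 0 at [V v] and 1 at the foot, so it complements the coordinate
   at [V v]. *)
exists (1 - al X v); have := al_sum X; rewrite (big_ord3_cycle _ v) => Xsum.
have := X0 v; have := X0 (v + 1); have := X0 (v + 2) => X2 X1 X0'.
split; first lra.
rewrite {1}(alE X) (big_ord3_cycle _ v) scalerDr !scalerA -addrA.
congr (_ *: _ + (_ *: _ + _ *: _)); [ring| |]; move: Xt Xsum; nra.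
Qed.

(** The two equations form a homogeneous linear system in the coordinates at [V (v + 1)] and
    [V (v + 2)], with determinant [s - t] up to sign; both coordinates therefore vanish. *)
Lemma ray_pencil v s t X : s != t ->
  s * al X (v + 1) = (1 - s) * al X (v + 2) ->
  t * al X (v + 1) = (1 - t) * al X (v + 2) -> X = V v.
Proof.
move=> st Xs Xt; have [e1 e2 e3] := ord3_neq v.
have st0 : s - t != 0 by rewrite subr_eq0.
have y0 : al X (v + 1) = 0.
  apply: (mulIf st0); rewrite mul0r.
  transitivity ((1 - t) * (s * al X (v + 1)) - (1 - s) * (t * al X (v + 1))); first by ring.
  by rewrite Xs Xt; ring.
have z0 : al X (v + 2) = 0.
  apply: (mulIf st0); rewrite mul0r.
  transitivity (s * ((1 - t) * al X (v + 2)) - t * ((1 - s) * al X (v + 2))); first by ring.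
  by rewrite -Xs -Xt; ring.
have := al_sum X; rewrite (big_ord3_cycle _ v) y0 z0 !addr0 => x1.
by apply: (al_inj (v := v)); rewrite al_vertex ?eqxx ?(negPf e1) ?x1 ?y0.
Qed.

(** Eliminating coordinates leaves one linear equation with leading coefficient [1 - s + s * t],
    positive because [s < 1]. With [s = 1] and [t = 0] both equations would describe the side
    joining [V v] and [V (v + 1)]. *)
Lemma ray_cross v s t X Y : 0 <= t <= 1 -> 0 <= s < 1 ->
  t * al X (v + 1) = (1 - t) * al X (v + 2) ->
  s * al X (v + 2) = (1 - s) * al X v ->
  t * al Y (v + 1) = (1 - t) * al Y (v + 2) ->
  s * al Y (v + 2) = (1 - s) * al Y v -> X = Y.
Proof.
move=> /andP[t0 t1] /andP[s0 s1] Xt Xs Yt Ys.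
have := al_sum X; have := al_sum Y; rewrite !(big_ord3_cycle _ v) => Ysum Xsum.
have D0 : 1 - s + s * t != 0 by apply: lt0r_neq0; nra.
have alv Z : t * al Z (v + 1) = (1 - t) * al Z (v + 2) ->
    s * al Z (v + 2) = (1 - s) * al Z v -> 
    al Z v = s * t / (1 - s + s * t) /\ al Z (v + 2) = t * (1 - al Z v).
  have := al_sum Z; rewrite !(big_ord3_cycle _ v) => Zsum Zt Zs.
  have z2 : al Z (v + 2) = t * (1 - al Z v) by nra.
  by split=> //; apply: (mulIf D0); rewrite divfK //; nra.
have [X0 X2] := alv _ Xt Xs; have [Y0 Y2] := alv _ Yt Ys.
apply: (al_inj (v := v)); first by rewrite X0 Y0.
by move: Xsum Ysum; rewrite X2 Y2 X0 Y0; lra.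
Qed.

Lemma ray_cross_ex v s t : 0 <= t <= 1 -> 0 <= s < 1 ->
  exists X, ray v t X /\ ray (v + 1) s X.
Proof.
move=> /andP[t0 t1] /andP[s0 s1].
have D0 : 0 < 1 - s + s * t by nra.
have [e1 e2 e3] := ord3_neq v; have [a11 a12 a21 a22] := ord3_add v.
(* The two cevian equations fix the coordinates up to scale as [t * s], [(1 - t) * (1 - s)],
   [t * (1 - s)], whose sum is the denominator. *)
pose c w := (if w == v then t * s else if w == v + 1 then (1 - t) * (1 - s)
  else t * (1 - s)) / (1 - s + s * t).
have csum : \sum_w c w = 1.
  rewrite (big_ord3_cycle _ v) /c !eqxx (negPf e1) (negPf e2) (negPf e3).
  by rewrite -!mulrDl; apply: (mulIf (lt0r_neq0 D0)); rewrite divfK ?lt0r_neq0 //; ring.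
have cge0 w : 0 <= c w.
  rewrite /c divr_ge0 ?(ltW D0) //; case: ifP => _; [|case: ifP => _];
  by rewrite mulr_ge0 // subr_ge0 // ltW.
exists (\sum_w c w *: V w).
split; apply/rayP; rewrite ?t0 ?s0 ?t1 ?ltW //; split=> [w|]; rewrite ?alK // ?a11 ?a12.
  by rewrite /c !eqxx (negPf e1) (negPf e2) (negPf e3); ring.
by rewrite /c !eqxx (negPf e2) (negPf e3); ring.
Qed.

Lemma ray_meet v w s t : 0 <= s < 1 -> 0 <= t < 1 ->
  exists X, ray v s X /\ ray w t X.
Proof.
move=> s01 t01; have [/andP[s0 s1] /andP[t0 t1]] := (s01, t01).
case: (ord3_cases v w) => ->.
- by exists (V v); split; exists 0; rewrite lexx ler01 subr0 scale1r scale0r addr0.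
- by apply: ray_cross_ex => //; rewrite s0 ltW.
(* Here [v] is the successor of [v + 2], so the previous case applies with the two rays
   exchanged. *)
- have [_ _ a21 _] := ord3_add v.
  have [||X [X1 X2]] := @ray_cross_ex (v + 2) s t => //; first by rewrite t0 ltW.
  by exists X; rewrite a21 in X2.
Qed.

Lemma ray_uniq v w s t X Y : 0 <= s < 1 -> 0 <= t < 1 -> (v, s) != (w, t) ->
  ray v s X -> ray w t X -> ray v s Y -> ray w t Y -> X = Y.
Proof.
move=> s01 t01; have [/andP[s0 s1] /andP[t0 t1]] := (s01, t01).
have [s01' t01'] : (0 <= s <= 1) /\ (0 <= t <= 1) by rewrite s0 t0 !ltW.
move=> vw /(rayP _ _ s01')[_ Xs] /(rayP _ _ t01')[_ Xt].
move=> /(rayP _ _ s01')[_ Ys] /(rayP _ _ t01')[_ Yt].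
have [a11 a12 a21 a22] := ord3_add v.
case: (ord3_cases v w) vw Xt Yt => ->.
- rewrite xpair_eqE eqxx /= => st Xt Yt.
  by rewrite (ray_pencil st Xs Xt) (ray_pencil st Ys Yt).
- by rewrite a11 a12 => _ Xt Yt; exact: ray_cross s01' t01 Xs Xt Ys Yt.
- rewrite a21 a22 => _ Xt Yt.
  by apply: (@ray_cross (v + 2) s t); rewrite ?a21 ?a22.
Qed.

Lemma ray_convex v t P Q : 0 <= t <= 1 -> ray v t P -> ray v t Q ->
  segment P Q `<=` ray v t.
Proof.
move=> t01 /(rayP _ _ t01)[P0 Pt] /(rayP _ _ t01)[Q0 Qt] X [s [/andP[s0 s1] ->]].
apply/rayP => //; split=> [w|]; rewrite !al_comb.
  by rewrite addr_ge0 // mulr_ge0 // subr_ge0.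
by rewrite mulrDr mulrDr mulrCA Pt [t * (s * _)]mulrCA Qt; ring.
Qed.

Lemma ray_line v t P Q S : ray v t P -> ray v t Q -> ray v t S ->
  ~~ noncollinear P Q S.
Proof.
move=> [p [_ ->]] [q [_ ->]] [s [_ ->]].
by rewrite !affine_comb; exact: noncollinear_line.
Qed.

(** The ratio equation is preserved by affine combinations, so it passes from [P] and [S] to [Q];
    nonnegativity of the coordinates of [Q] comes from the other ray. *)
Lemma ray_extend v w s t P Q S : 0 <= s <= 1 -> 0 <= t <= 1 ->
  ray v s P -> ray v s S -> P <> S -> ray w t Q -> ~~ noncollinear P Q S ->
  ray v s Q.
Proof.
move=> s01 t01 /(rayP _ _ s01)[_ Ps] /(rayP _ _ s01)[_ Ss] PS /(rayP _ _ t01)[Q0 _] col.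
apply/rayP => //; split=> //; have [k ->] := collinear_comb PS col.
by rewrite !al_comb mulrDr mulrDr mulrCA Ps [s * (k * _)]mulrCA Ss; ring.
Qed.

(** Besides the rays that start at [V v], only the side arriving from [V (v + 2)] reaches it. *)
Lemma ray_vertex v w t : 0 <= t < 1 ->
  ray w t (V v) <-> w = v \/ w = v + 2 /\ t = 0.
Proof.
move=> /andP[t0 t1]; have t01 : 0 <= t <= 1 by rewrite t0 ltW.
have [e1 e2 e3] := ord3_neq v; have [a11 a12 a21 a22] := ord3_add v.
split=> [/(rayP _ _ t01)[_]|wv]; last first.
  apply/rayP => //; split=> [u|]; first by rewrite al_vertex.
  rewrite !al_vertex; case: wv => [->|[-> ->]].
    by rewrite (negPf e1) (negPf e2) !mulr0.
  by rewrite a22 (negPf e1) mul0r mulr0.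
rewrite !al_vertex; case: (ord3_cases v w) => ->.
- by left.
- by rewrite a11 a12 (negPf e2) eqxx mulr0 mulr1 => /esym /eqP; rewrite subr_eq0 gt_eqF.
- by rewrite a21 a22 (negPf e1) eqxx mulr0 mulr1; right.
Qed.

(** For [s = 0] the first ray is the side from [V v] to [V (v + 1)], which a ray from [V (v + 1)] of
    parameter below 1 meets only at that vertex. This will exclude sides from triple points. *)
Lemma ray_param_gt0 v s t X : 0 <= s < 1 -> 0 <= t < 1 ->
  ray v s X -> ray (v + 1) t X -> X <> V (v + 1) -> 0 < s.
Proof.
move=> /andP[s0 s1] /andP[t0 t1] Xs Xt XV; rewrite lt0r s0 andbT; apply/eqP => sE.
have [e1 e2 e3] := ord3_neq v; have [a11 a12 _ _] := ord3_add v.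
have /rayP[|_] := Xs; first by rewrite s0 ltW.
rewrite sE mul0r subr0 mul1r => /esym z0.
have /rayP[|_] := Xt; first by rewrite t0 ltW.
rewrite a11 a12 z0 mulr0 => /esym/eqP; rewrite mulf_eq0 subr_eq0 (gt_eqF t1) /= => /eqP x0.
apply: XV; have := al_sum X; rewrite (big_ord3_cycle _ v) z0 x0 add0r addr0 => y1.
by apply: (al_inj (v := v)); rewrite al_vertex ?eqxx 1?[v == _]eq_sym ?(negPf e1).
Qed.

Lemma ray_al_gt0 v s X : 0 < s < 1 -> ray v s X -> X <> V v ->
  0 < al X (v + 1) /\ 0 < al X (v + 2).
Proof.
move=> /andP[s0 s1] Xs XV; have /rayP[|X0 XE] := Xs; first by rewrite !ltW.
have [e1 e2 e3] := ord3_neq v.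
have s1' : 1 - s != 0 by rewrite subr_eq0 gt_eqF.
suff yz : al X (v + 1) != 0 /\ al X (v + 2) != 0.
  by rewrite !lt0r !X0 !andbT.
have XVv : al X (v + 1) = 0 -> al X (v + 2) = 0 -> False.
  move=> y0 z0; apply: XV; have := al_sum X; rewrite (big_ord3_cycle _ v) y0 z0 !addr0.
  by move=> x1; apply: (al_inj (v := v)); rewrite al_vertex ?eqxx ?(negPf e1) ?x1 ?y0.
split; apply/eqP => E; apply: XVv => //; apply/eqP; move/eqP: XE; rewrite E mulr0.
  by rewrite eq_sym mulf_eq0 (negPf s1').
by rewrite mulf_eq0 (gt_eqF s0).
Qed.

Lemma triangle_regionP X :
  triangle_region (V 0) (V 1) (V 2) X <-> forall w, 0 <= al X w.
Proof.
split=> [[x [y [z [x0 y0 z0 xyz ->]]]] w|X0].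
  pose c (w : 'I_3) := [:: x; y; z]`_w.
  have VE : x *: V 0 + y *: V 1 + z *: V 2 = \sum_w c w *: V w.
    by rewrite (big_ord3_cycle _ 0) !add0r.
  rewrite VE alK; first by case: w => [[|[|[|//]]] ?].
  by rewrite (big_ord3_cycle _ 0).
exists (al X 0), (al X 1), (al X 2); split=> //.
  by rewrite -(al_sum X) (big_ord3_cycle _ 0) !add0r.
by rewrite {1}(alE X) (big_ord3_cycle _ 0) !add0r.
Qed.

Hypothesis al_continuous : forall w, continuous (al^~ w).

(** Positivity of the three coordinates is an open condition by continuity. *)
Lemma interior_triangle X : (forall w, 0 < al X w) ->
  interior (triangle_region (V 0) (V 1) (V 2)) X.
Proof.
move=> X0; apply: (@filterS _ _ _ (fun Y => [/\ 0 < al Y 0, 0 < al Y 1 & 0 < al Y 2])).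
  move=> Y [Y0 Y1 Y2]; apply/triangle_regionP => w.
  by case: (ord3_cases 0 w) => ->; rewrite ?add0r ltW.
have gt0 w : \forall Y \near X, 0 < al Y w.
  by have /cvgr_gt/(_ _ (X0 w)) := @al_continuous w X.
near=> Y; split; near: Y; exact: gt0.
Unshelve. all: by end_near.
Qed.

Lemma vertex_not_interior v : ~ interior (triangle_region (V 0) (V 1) (V 2)) (V v).
Proof.
(* A side line is followed backwards beyond [V v]: for negative [e] the coordinate at [V (v + 1)] is
   [e], so points arbitrarily near the vertex lie outside the triangle. *)
move=> iV; pose Y (e : R) := (1 - e) *: V v + e *: V (v + 1).
have Yc : {for 0, continuous Y}.
  apply: continuousD; apply: continuousZl => //.
  by apply: continuousB => //; exact: cst_continuous.
have : nbhs (Y 0) (triangle_region (V 0) (V 1) (V 2)).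
  by rewrite /Y subr0 scale1r scale0r addr0.
move/Yc => /nbhs_ballP[e /= e0 be].
have /triangle_regionP/(_ (v + 1)) : triangle_region (V 0) (V 1) (V 2) (Y (- (e / 2))).
  apply: be; rewrite /ball /= sub0r opprK ger0_norm; lra.
have [e1 _ _] := ord3_neq v.
rewrite /Y al_comb !al_vertex eqxx (negPf e1) mulr0 add0r mulr1.
lra.
Qed.
End Barycentric.

(** * Existence and continuity of barycentric coordinates *)

Lemma affine_comb3 (K : pzRingType) (E : lmodType K) (W Y Z : E) (p q : K) :
  W + (p *: (Y - W) + q *: (Z - W)) = (1 - p - q) *: W + p *: Y + q *: Z.
Proof.
by rewrite !scalerBr !scalerBl scale1r addrACA [p *: Y + _ + _]addrC !addrA.
Qed.

Lemma linear_continuous_row (R : realType) n (f : {linear 'rV[R]_n -> R^o}) :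
  continuous f.
Proof.
have fE u : f u = \sum_j u 0 j * f (delta_mx 0 j).
  by rewrite {1}(row_sum_delta u) linear_sum; apply: eq_bigr => j _; rewrite linearZ.
move=> u; rewrite (funext fE).
apply: cvg_big => [||j _]; [exact: add_continuous|exact: nbhs_filter|].
exact: cvgMr_tmp (@coord_continuous _ _ _ 0 j u).
Qed.

(** The vectors [B - A] and [C - A] form a basis of the plane. The coordinates of [X - A] in it are
    those at [B] and [C], and the one at [A] completes the sum to 1. *)
Lemma barycentric_ex (R : realType) (A B C : plane R) : noncollinear A B C ->
  exists al : plane R -> 'I_3 -> R, let V (w : 'I_3) := [:: A; B; C]`_w in
  [/\ forall X, \sum_w al X w = 1, forall X, X = \sum_w al X w *: V w,
      forall c : 'I_3 -> R, \sum_w c w = 1 -> 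
        forall w, al (\sum_u c u *: V u) w = c w
    & forall w, continuous (al^~ w)].
Proof.
move=> ABC; pose b := [tuple B - A; C - A].
have fb : free b by [].
have bfull X : X \in <<b>>%VS.
  suff /eqP-> : <<b>>%VS == fullv by exact: memvf.
  by rewrite eqEdim subvf dimvf (eqP fb) dim_matrix /=.
pose c i X := coord b i (X - A).
have cE X : X = A + (c 0 X *: (B - A) + c 1 X *: (C - A)).
  have := coord_span (bfull (X - A)); rewrite !big_ord_recl big_ord0 addr0 /=.
  move=> E; rewrite -[LHS](subrKC A); congr (A + _); rewrite {1}E.
  by congr (_ *: _ + coord b _ _ *: _); exact: val_inj.
have cc i : continuous (c i).
  move=> X.
  have sc : {for X, continuous (fun Y : plane R => Y - A)}.
    by apply: continuousB => //; exact: cst_continuous.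
  exact: cvg_comp sc (linear_continuous_row (f := coord b i) (x := X - A)).
exists (fun X w => [:: 1 - c 0 X - c 1 X; c 0 X; c 1 X]`_w) => V; split.
- by move=> X; rewrite (big_ord3_cycle _ 0) !add0r /=; ring.
- by move=> X; rewrite (big_ord3_cycle _ 0) !add0r /V /= {1}(cE X) affine_comb3.
- move=> k; rewrite (big_ord3_cycle _ 0) !add0r => k1 w.
  have k0 : k 0 = 1 - k 1 - k 2 by rewrite -k1; ring.
  set X := \sum_u _; have XE : X - A = k 1 *: b`_0%R + k 2 *: b`_1%R.
    by rewrite /X (big_ord3_cycle _ 0) !add0r /V k0 /= -affine_comb3 addrC addKr.
  have ck (i : 'I_2) : c i X = k 1 * (0 == i)%:R + k 2 * (1 == i)%:R.
    by rewrite /c XE linearD !linearZ /= (coord_free 0) ?(coord_free 1).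
  rewrite !ck /= !mulr1 !mulr0 addr0 add0r -k0.
  by case: w => [[|[|[|//]]] ?] /=; congr k; exact: val_inj.
- case=> [[|[|[|//]]] ?] X /=; [|exact: cc|exact: cc].
  exact: cvgB (cvgB (cvg_cst _) (@cc 0 X)) (@cc 1 X).
Qed.

(** * Counting concurrent triples *)

Section Count.
Variables (R : realType) (V : 'I_3 -> plane R) (al : plane R -> 'I_3 -> R).
Hypothesis al_sum : forall X, \sum_v al X v = 1.
Hypothesis alE : forall X, X = \sum_v al X v *: V v.
Hypothesis alK : forall c : 'I_3 -> R, \sum_v c v = 1 ->
  forall v, al (\sum_w c w *: V w) v = c v.
Hypothesis al_continuous : forall w, continuous (al^~ w).
(** Segment [i] starts at [V (p i)] and has foot parameter [t i]. The half-open range of [t] lists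
    each side once, as the parameter 0 at one of its two ends. *)
Variables (L : finType) (p : L -> 'I_3) (t : L -> R).
Hypothesis t01 : forall i, 0 <= t i < 1.
Hypothesis pt_inj : forall i j, p i = p j -> t i = t j -> i = j.
Hypothesis side_ex : forall v, exists2 i, p i = v & t i = 0.

Definition seg i := ray V (p i) (t i).

Lemma seg_uniq i j X Y : i != j ->
  seg i X -> seg j X -> seg i Y -> seg j Y -> X = Y.
Proof.
move=> ij; apply: (ray_uniq al_sum alE alK (t01 i) (t01 j)).
by apply: contra ij => /eqP[pij tij]; apply/eqP; exact: pt_inj.
Qed.

Lemma seg_vertex i : seg i (V (p i)).
Proof. by case: (segment_ends (V (p i)) ((1 - t i) *: V (p i + 1) + t i *: V (p i + 2))). Qed.

Lemma V_inj : injective V.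
Proof.
move=> v w vw; have := al_vertex alK v v; rewrite vw (al_vertex alK) eqxx.
by case: (v =P w) => // _ /esym/eqP; rewrite oner_eq0.
Qed.

Lemma t01w i : 0 <= t i <= 1.
Proof. by have /andP[-> /ltW] := t01 i. Qed.

Lemma seg_triangles_card :
  finite_set (formed_triangles (range seg)) /\
  #|` fset_set (formed_triangles (range seg))|%fset =
    #|finset (fun W : {set L} => (#|W| == 3) && ~~ concurrent seg W)|.
Proof.
apply: formed_triangles_card.
- by move=> i P Q; exact: ray_convex (t01w i).
- by move=> i j _; exact: ray_meet (t01 i) (t01 j).
- exact: seg_uniq.
- by move=> i P Q S; exact: ray_line.
- by move=> i j P Q S iP iS PS jQ; exact: ray_extend (t01w i) (t01w j) iP iS PS jQ.
Qed.

Lemma card_through_vertex v :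
  #|through seg (V v)| = #|finset (fun i => p i == v)|.+1.
Proof.
have [e1 e2 _] := ord3_neq v.
(* This is the side arriving at [V v], the one segment through [V v] that is not counted as starting
   there. *)
have [i0 pi0 ti0] := side_ex (v + 2).
rewrite (_ : through seg (V v) = i0 |: finset (fun i => p i == v))%SET.
  by rewrite cardsU1 inE pi0 e2.
apply/setP => i; rewrite !inE; apply/asboolP/orP.
  move/(ray_vertex al_sum alE alK _ _ (t01 i)) => [->|[pi ti]]; [right|left] => //.
  by apply/eqP/pt_inj; rewrite ?pi0 ?ti0.
move=> h; apply/(ray_vertex al_sum alE alK _ _ (t01 i)).
by case: h => /eqP; [move->; right|left].
Qed.

(** Two segments from the same vertex already meet there, so by [seg_uniq] they share no other
    point. *)
Lemma p_inj_through X : (forall v, X <> V v) -> {in through seg X &, injective p}.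
Proof.
move=> XV i j /in_through iX /in_through jX pij; apply/eqP/negPn/negP => ij.
apply: (XV (p i)); apply: (seg_uniq ij iX jX); first exact: seg_vertex.
by rewrite pij; exact: seg_vertex.
Qed.

Lemma card_through_le3 X : (forall v, X <> V v) -> (#|through seg X| <= 3)%N.
Proof.
move=> XV; rewrite -(card_in_imset (p_inj_through XV)) -[leqRHS]card_ord.
exact: max_card.
Qed.

Definition crossings : set (plane R) :=
  [set X | (forall v, X <> V v) /\ (2 < #|through seg X|)%N].

Lemma through_uniq (W : {set L}) X Y : (1 < #|W|)%N ->
  W \subset through seg X -> W \subset through seg Y -> X = Y.
Proof.
move=> /card_gt1P[i [j [iW jW ij]]] /fintype.subsetP sX /fintype.subsetP sY.
have throughE Z k : k \in through seg Z -> seg k Z by move/in_through.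
by apply: (seg_uniq ij); apply: throughE; [exact: sX|exact: sX|exact: sY|exact: sY].
Qed.

(** All 3-subsets of segments are classified: non-concurrent, concurrent at a vertex, or concurrent
    elsewhere, where the triple is the whole set of segments through the point. *)
Lemma crossings_card :
  finite_set crossings /\
  ('C(#|L|, 3) = #|finset (fun W : {set L} => (#|W| == 3) && ~~ concurrent seg W)| +
    \sum_v 'C(#|finset (fun i => p i == v)|.+1, 3) + #|` fset_set crossings|%fset)%N.
Proof.
have [|fint ->] := @card_fset_set_inj _ _ crossings (through seg).
  move=> X Y [_ X3] _ XY; apply: (@through_uniq (through seg X)); first exact: ltnW.
    exact: subxx.
  by rewrite XY.
split=> //; rewrite -card_draws.
(* Each binomial becomes the number of 3-subsets of the segments through a vertex, so that every
   term is a sum over 3-subsets [W]. *)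
under eq_bigr => v _ do rewrite -card_through_vertex -cards_draws.
rewrite -!sum1dep_card.
under [X in (_ + X + _)%N]eq_bigr => v _ do rewrite -sum1dep_card big_mkcondl.
rewrite exchange_big /=.
rewrite [X in (X + _ + _)%N]big_mkcondr /=.
have -> : (\sum_(W : {set L} | `[< exists2 X, crossings X & through seg X = W >]) 1 =
  \sum_(W : {set L} | #|W| == 3)
    if `[< exists2 X, crossings X & through seg X = W >] then 1 else 0)%N.
  rewrite -big_mkcondr; apply: eq_bigl => W; apply/idP/andP => [|[]//].
  move=> h; split=> //; have /asboolP[X [XV X3] <-] := h.
  by rewrite eqn_leq X3 card_through_le3.
(* It remains to see that each [W] contributes exactly 1 in total; by [through_uniq] it has at most
   one common point. *)
rewrite -!big_split /=; apply: eq_bigr => W /eqP W3.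
have W2 : (1 < #|W|)%N by rewrite W3.
have [/asboolP[X WX]|nc] /= := boolP (concurrent seg W); last first.
  rewrite big1 => [|v _]; last first.
    by case: ifP => // Wv; case/negP: nc; apply/asboolP; exists (V v).
  case: asboolP => // -[X _ XW]; case/negP: nc; apply/asboolP; exists X; by rewrite XW.
rewrite add0n; have [[v XV]|XV] := pselect (exists v, X = V v).
  rewrite (bigD1 v) //= -XV WX big1 => [|w wv]; last first.
    case: ifP => // Ww; move/eqP: wv; case; apply: V_inj; rewrite -XV.
    exact: through_uniq W2 Ww WX.
  case: asboolP => // -[Y [YV _] YW]; case: (YV v); rewrite -XV.
  by apply: through_uniq W2 _ WX; rewrite YW subxx.
have XV' v : X <> V v by move=> E; apply: XV; exists v.
rewrite big1 => [|v _]; last first.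
  by case: ifP => // Wv; case: (XV' v); exact: through_uniq W2 WX Wv.
(* Away from the vertices at most three segments pass through [X], so [W] is all of them. *)
have E : W = through seg X.
  by apply/eqP; rewrite eqEcard WX W3 card_through_le3.
case: asboolP => // -[]; exists X => //; split=> //.
by rewrite -E W3.
Qed.

Lemma triple_points_crossings :
  triple_points (V 0) (V 1) (V 2) (seg @` [set i | 0 < t i]) = crossings.
Proof.
apply/seteqP; split=> X.
  move=> [inX [s1 [s2 [s3 [[[i _ iE] [j _ jE] [k _ kE]] [[ij jk ik] [iX jX kX]]]]]]].
  subst s1 s2 s3; split=> [v XV|].
    by apply: (vertex_not_interior al_sum alE alK (v := v)); rewrite -XV.
  suff /esym/eq_leq ijk : #|(i |: [set j; k])%SET| = 3.
    apply: (leq_trans ijk); apply/subset_leq_card/fintype.subsetP => l.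
    by rewrite in_set3 => /or3P[]/eqP->; apply/in_through.
  have [nij njk nik] : [/\ i != j, j != k & i != k].
    by split; apply/eqP => E; [apply: ij|apply: jk|apply: ik]; rewrite E.
  by rewrite cardsU1 cards2 !inE negb_or nij njk nik.
move=> [XV X3].
(* On the segments through [X] the map [p] is injective, and there are at least three of them, so
   every vertex is the start of one. *)
have pX v : exists2 i, p i = v & seg i X.
  have /eqP pT : (p @: through seg X)%SET == [set: 'I_3]%SET.
    by rewrite eqEcard finset.subsetT cardsT card_ord (card_in_imset (p_inj_through XV)).
  have /imsetP[i /in_through iX ->] : v \in (p @: through seg X)%SET by rewrite pT finset.in_setT.
  by exists i.
have gt0 v : exists i, [/\ p i = v, seg i X & 0 < t i].
  have [i pi iX] := pX v; have [j pj jX] := pX (v + 1); exists i; split=> //.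
  move: iX jX; rewrite /seg pi pj => iX jX.
  exact: (ray_param_gt0 al_sum alE alK (t01 i) (t01 j) iX jX).
split.
  apply: (interior_triangle al_sum alE alK al_continuous) => w.
  (* The coordinate at [V w] is read off a cevian from the preceding vertex [V (w + 2)], on which it
     is positive away from that vertex. *)
  have [i [pi iX ti]] := gt0 (w + 2); have /andP[_ t1] := t01 i.
  have [_ _ a21 _] := ord3_add w.
  move: iX; rewrite /seg pi => iX.
  have [|] := ray_al_gt0 al_sum alE alK _ iX (XV _); first by rewrite ti t1.
  by rewrite a21.
have neq i j : seg i X -> seg j X -> p i != p j -> seg i <> seg j.
  move=> iX jX pij sij.
  have ij : i != j by apply: contra pij => /eqP->.
  apply: (XV (p i)); apply: (seg_uniq ij iX jX); first exact: seg_vertex.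
  by rewrite -sij; exact: seg_vertex.
have [i [pi iX ti]] := gt0 0; have [j [pj jX tj]] := gt0 1; have [k [pk kX tk]] := gt0 2.
exists (seg i), (seg j), (seg k); split; [|split] => //.
by split; apply: neq; rewrite ?pi ?pj ?pk.
Qed.
End Count.

(** * Application to the given triangle and cevians *)

Lemma cevian_param (R : realType) (U P Q : plane R) n (cev : 'I_n -> set (plane R)) :
  (forall i, is_cevian U P Q (cev i)) ->
  exists t : 'I_n -> R, forall i,
    0 < t i < 1 /\ cev i = segment U ((1 - t i) *: P + t i *: Q).
Proof.
move=> cevP; suff /choice[t tP] : forall i, exists t : R, 0 < t < 1 /\
    cev i = segment U ((1 - t) *: P + t *: Q) by exists t.
by move=> i; have [D [t [t01 ->]] ->] := cevP i; exists t.
Qed.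

Theorem theorem1 (R : realType) (A B C : plane R) (a b c : nat)
    (cevA : 'I_a -> set (plane R)) (cevB : 'I_b -> set (plane R))
    (cevC : 'I_c -> set (plane R))
    (ABC_triangle : noncollinear A B C)
    (cevA_cevian : forall i, is_cevian A B C (cevA i))
    (cevB_cevian : forall i, is_cevian B C A (cevB i))
    (cevC_cevian : forall i, is_cevian C A B (cevC i))
    (cevA_inj : injective cevA) (cevB_inj : injective cevB)
    (cevC_inj : injective cevC) :
  let cevians := range cevA `|` range cevB `|` range cevC in
  let triangles := formed_triangles (sides A B C `|` cevians) in
  let meets := triple_points A B C cevians in
  [/\ finite_set triangles, finite_set meets &
      (#|` fset_set triangles|%fset)%:Z =
        'C(a + b + c + 3, 3)%:Z - 'C(a + 2, 3)%:Z - 'C(b + 2, 3)%:Z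
          - 'C(c + 2, 3)%:Z - (#|` fset_set meets|%fset)%:Z].
Proof.
move=> cevians triangles meets.
pose V (w : 'I_3) := [:: A; B; C]`_w.
have [al [al_sum alE alK al_cont]] := barycentric_ex ABC_triangle.
rewrite -/V in alE alK.
have [tA tAP] := cevian_param cevA_cevian.
have [tB tBP] := cevian_param cevB_cevian.
have [tC tCP] := cevian_param cevC_cevian.
(* In each summand [None] stands for the side leaving that vertex, in the order AB, BC, CA, and
   [Some] for the cevians. *)
pose L := (option 'I_a + (option 'I_b + option 'I_c))%type.
pose p (i : L) : 'I_3 := match i with inl _ => 0 | inr (inl _) => 1 | inr (inr _) => 2 end.
pose t (i : L) : R := match i with
  | inl (Some j) => tA j | inr (inl (Some j)) => tB j | inr (inr (Some j)) => tC j
  | _ => 0 end.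
have tA01 j : 0 < tA j < 1 by have [] := tAP j.
have tB01 j : 0 < tB j < 1 by have [] := tBP j.
have tC01 j : 0 < tC j < 1 by have [] := tCP j.
have t01 i : 0 <= t i < 1.
  by case: i => [[j|]|[[j|]|[j|]]] /=; rewrite ?lexx ?ltr01 //;
    apply/andP; split; rewrite ?ltW //;
    [have /andP[] := tA01 j|have /andP[] := tA01 j|have /andP[] := tB01 j
    |have /andP[] := tB01 j|have /andP[] := tC01 j|have /andP[] := tC01 j].
have pt_inj i j : p i = p j -> t i = t j -> i = j.
  have nz x : 0 < x < 1 -> x <> 0 :> R by move=> /andP[x0 _] xE; rewrite xE ltxx in x0.
  have tA_inj : injective tA.
    by move=> k l kl; apply: cevA_inj; have [_ ->] := tAP k; have [_ ->] := tAP l; rewrite kl.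
  have tB_inj : injective tB.
    by move=> k l kl; apply: cevB_inj; have [_ ->] := tBP k; have [_ ->] := tBP l; rewrite kl.
  have tC_inj : injective tC.
    by move=> k l kl; apply: cevC_inj; have [_ ->] := tCP k; have [_ ->] := tCP l; rewrite kl.
  have nzA k : tA k <> 0 by exact: nz.
  have nzB k : tB k <> 0 by exact: nz.
  have nzC k : tC k <> 0 by exact: nz.
  case: i j => [[i|]|[[i|]|[i|]]] [[j|]|[[j|]|[j|]]] //= _;
    by [move/tA_inj->|move/tB_inj->|move/tC_inj->|move/nzA|move/nzB|move/nzC
       |move/esym/nzA|move/esym/nzB|move/esym/nzC].
have side_ex v : exists2 i, p i = v & t i = 0.
  case: (ord3_cases 0 v) => ->; rewrite ?add0r;
    by [exists (inl None)|exists (inr (inl None))|exists (inr (inr None))].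
have [segA segB segC] : [/\ forall j, seg V p t (inl (Some j)) = cevA j,
    forall j, seg V p t (inr (inl (Some j))) = cevB j &
    forall j, seg V p t (inr (inr (Some j))) = cevC j].
  split=> j; [have [_ ->] := tAP j|have [_ ->] := tBP j|have [_ ->] := tCP j]; by [].
have [sideAB sideBC sideCA] : [/\ seg V p t (inl None) = segment A B,
    seg V p t (inr (inl None)) = segment B C & seg V p t (inr (inr None)) = segment C A].
  by split; rewrite /seg /ray /= subr0 scale1r scale0r addr0.
have triangleE : triangles = formed_triangles (range (seg V p t)).
  congr formed_triangles; apply/seteqP; split=> s.
    move=> [[[->|->]|->]|[[[j _ <-]|[j _ <-]]|[j _ <-]]].
    - by exists (inr (inl None)).
    - by exists (inr (inr None)).
    - by exists (inl None).
    - by exists (inl (Some j)).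
    - by exists (inr (inl (Some j))).
    - by exists (inr (inr (Some j))).
  move=> [[[j|]|[[j|]|[j|]]] _ <-]; rewrite ?segA ?segB ?segC ?sideAB ?sideBC ?sideCA.
  - by right; left; left; exists j.
  - by left; right.
  - by right; left; right; exists j.
  - by left; left; left.
  - by right; right; exists j.
  - by left; left; right.
have meetsE : meets = crossings V p t.
  rewrite -(triple_points_crossings al_sum alE alK al_cont t01 pt_inj).
  congr triple_points; apply/seteqP; split=> s.
    move=> [[[j _ <-]|[j _ <-]]|[j _ <-]].
    - by exists (inl (Some j)) => //=; have /andP[] := tA01 j.
    - by exists (inr (inl (Some j))) => //=; have /andP[] := tB01 j.
    - by exists (inr (inr (Some j))) => //=; have /andP[] := tC01 j.
  move=> [[[j|]|[[j|]|[j|]]] /= t0 <-]; rewrite ?ltxx // in t0 *; rewrite ?segA ?segB ?segC.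
  - by left; left; exists j.
  - by left; right; exists j.
  - by right; exists j.
have [finT cardT] := seg_triangles_card al_sum alE alK t01 pt_inj.
have [finM cardM] := crossings_card al_sum alE alK t01 pt_inj side_ex.
rewrite -triangleE in finT cardT; rewrite -meetsE in finM cardM.
split=> //.
(* Each vertex starts its cevians and one side; the successor in [crossings_card] adds the side
   arriving there, which gives [a + 2], [b + 2] and [c + 2]. *)
have [cA cB cC] : [/\ #|finset (fun i => p i == 0)| = a.+1,
    #|finset (fun i => p i == 1)| = b.+1 & #|finset (fun i => p i == 2)| = c.+1].
  have inj_inrl : injective (fun i : option 'I_b => inr (inl i) : L) by move=> i j [].
  have inj_inrr : injective (fun i : option 'I_c => inr (inr i) : L) by move=> i j [].
  have inj_inl : injective (fun i : option 'I_a => inl i : L) by move=> i j [].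
  split.
  - rewrite -[in RHS](card_ord a) -card_option -(card_imset predT inj_inl).
    apply: eq_card => i; rewrite inE; apply/idP/imsetP => [|[j _ ->]//].
    by case: i => [j|[j|j]] // _; exists j.
  - rewrite -[in RHS](card_ord b) -card_option -(card_imset predT inj_inrl).
    apply: eq_card => i; rewrite inE; apply/idP/imsetP => [|[j _ ->]//].
    by case: i => [j|[j|j]] // _; exists j.
  - rewrite -[in RHS](card_ord c) -card_option -(card_imset predT inj_inrr).
    apply: eq_card => i; rewrite inE; apply/idP/imsetP => [|[j _ ->]//].
    by case: i => [j|[j|j]] // _; exists j.
have cL : #|{: L}| = (a + b + c + 3)%N.
  by rewrite !card_sum !card_option !card_ord; lia.
(* The count is additive over the naturals; substituting it for the first binomial leaves an
   identity over the integers. *)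
move: cardM; rewrite cL (big_ord3_cycle _ 0) !add0r cA cB cC -cardT !addn2 => ->.
rewrite !PoszD; ring.
Qed.
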